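(* Let $\tau$ be a finite nonempty set of proposition symbols and let $n,d,d'\in\mathbb Z_+$. If $d<d'\le n/2$, then \[H_S(\equiv_d)<H_S(\equiv_{d'})\quad\text{and}\quad H_B(\equiv_d)>H_B(\equiv_{d'}).\] Furthermore, if $n/2\le d\le d'$, then \[H_S(\equiv_d)=H_S(\equiv_{d'})\quad\text{and}\quad H_B(\equiv_d)=H_B(\equiv_{d'}).\]
   Context: Models: a $\tau$-model with domain $W$ assigns to each $p\in\tau$ a subset of $W$ (the points where $p$ is true). $\mathcal M$ is the set of all $\tau$-models with domain $\{1,\dots,n\}$, so $|\mathcal M|=2^{n|\tau|}$. Logic: propositional formulas are $\psi ::= p\mid\neg p\mid\psi\wedge\psi\mid\psi\vee\psi$ with $p\in\tau$. Formulas of $\mathrm{GMLU}$ are built from $\diamond^{\ge k}\psi$, $\blacksquare^{<k}\psi$, $\diamond^{=k}\psi$, $\blacksquare^{\ne k}\psi$ ($\psi$ propositional, $k\in\mathbb N$) by closing under $\wedge,\vee$ and under prefixing $\diamond^{\ge k},\blacksquare^{<k},\diamond^{=k},\blacksquare^{\ne k}$. Semantics at a point $w$: Boolean connectives as usual; $\diamond^{\ge k}\varphi$ (resp. $\diamond^{=k}\varphi$) holds iff at least (resp. exactly) $k$ points of the domain satisfy $\varphi$; $\blacksquare^{<k}\varphi$ is equivalent to $\neg\diamond^{\ge k}\neg\varphi$ and $\blacksquare^{\ne k}\varphi$ to $\neg\diamond^{=k}\neg\varphi$. Truth of a $\mathrm{GMLU}$-formula in a model does not depend on the point, so $\mathfrak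 M\vDash\varphi$ is well defined. $\mathrm{GMLU}_d$ is the set of formulas of counting depth at most $d$, i.e. in which every occurring $\diamond^{\ge k},\blacksquare^{<k}$ has $k\le d$ and every occurring $\diamond^{=k},\blacksquare^{\ne k}$ has $k+1\le d$. $\mathfrak M\equiv_d\mathfrak N$ iff $\mathfrak M,\mathfrak N\in\mathcal M$ satisfy the same $\mathrm{GMLU}_d$-formulas. Entropies: for an equivalence class $M$ of $\equiv_d$ put $p_{\equiv_d}(M)=|M|/|\mathcal M|$ and $H_B(M)=\log_2|M|$. Then $H_B(\equiv_d):=\sum_{M\in\mathcal M/\equiv_d}p_{\equiv_d}(M)H_B(M)$ and $H_S(\equiv_d):=-\sum_{M\in\mathcal M/\equiv_d}p_{\equiv_d}(M)\log_2 p_{\equiv_d}(M)$. *)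

(* Defs.v *)
From mathcomp Require Import all_boot all_order all_algebra.
From mathcomp Require Import boolp reals exp.

Set Implicit Arguments.
Unset Strict Implicit.
Unset Printing Implicit Defensive.

Import Order.TTheory GRing.Theory Num.Theory.
Local Open Scope ring_scope.

(* The domain {1, ..., n} is rendered by 'I_n. *)
Definition model (tau : finType) (n : nat) := {ffun tau -> {set 'I_n}}.

Inductive pform (tau : Type) : Type :=
| PVar of tau
| PNeg of tau
| PAnd of pform tau & pform tau
| POr of pform tau & pform tau.

Inductive modality : Type :=
| DiaGe of nat
| BoxLt of nat
| DiaEq of nat
| BoxNe of nat.

(* Propositional formulas occur only directly under a modality. *)
Inductive gmlu (tau : Type) : Type :=
| GModP of modality & pform tau
| GMod of modality & gmlu tau
| GAnd of gmlu tau & gmlu tau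
| GOr of gmlu tau & gmlu tau.

(* A is the set of points satisfying the formula under the modality, so that
   ~: A is the set of points satisfying its negation. *)
Definition modality_sat (T : finType) (q : modality) (A : {set T}) : bool :=
  match q with
  | DiaGe k => (k <= #|A|)%N
  | BoxLt k => ~~ (k <= #|~: A|)%N
  | DiaEq k => #|A| == k
  | BoxNe k => #|~: A| != k
  end.

Fixpoint psat (tau : finType) (n : nat) (M : model tau n) (w : 'I_n)
    (f : pform tau) : bool :=
  match f with
  | PVar p => w \in M p
  | PNeg p => w \notin M p
  | PAnd f1 f2 => psat M w f1 && psat M w f2
  | POr f1 f2 => psat M w f1 || psat M w f2
  end.

Fixpoint gsat (tau : finType) (n : nat) (M : model tau n) (w : 'I_n)
    (f : gmlu tau) : bool :=
  match f with
  | GModP q g => modality_sat q [set v | psat M v g]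
  | GMod q g => modality_sat q [set v | gsat M v g]
  | GAnd f1 f2 => gsat M w f1 && gsat M w f2
  | GOr f1 f2 => gsat M w f1 || gsat M w f2
  end.

Definition msat (tau : finType) (n : nat) (M : model tau n) (f : gmlu tau) :
    bool := [forall w, gsat M w f].

Lemma gsat_indep (tau : finType) (n : nat) (M : model tau n) (f : gmlu tau)
  (v w : 'I_n) : gsat M v f = gsat M w f.
Proof. by elim: f => //= f1 -> f2 ->. Qed.

Lemma msatE (tau : finType) (n : nat) (M : model tau n) (f : gmlu tau)
  (w : 'I_n) : msat M f = gsat M w f.
Proof.
apply/forallP/idP => [/(_ w)//|Mw v].
by rewrite (gsat_indep M f v w).
Qed.

Definition modality_depth (q : modality) : nat :=
  match q with
  | DiaGe k | BoxLt k => k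
  | DiaEq k | BoxNe k => k.+1
  end.

Fixpoint cdepth (tau : Type) (f : gmlu tau) : nat :=
  match f with
  | GModP q _ => modality_depth q
  | GMod q g => maxn (modality_depth q) (cdepth g)
  | GAnd f1 f2 | GOr f1 f2 => maxn (cdepth f1) (cdepth f2)
  end.

Definition gmlu_equiv (tau : finType) (n d : nat) (M N : model tau n) : Prop :=
  forall f : gmlu tau, (cdepth f <= d)%N -> msat M f = msat N f.

Definition gmlu_classes (tau : finType) (n d : nat) : {set {set model tau n}} :=
  equivalence_partition (fun M N : model tau n => `[< gmlu_equiv d M N >])
    [set: model tau n].

Definition log2 (R : realType) (x : R) : R := ln x / ln 2.

Definition class_prob (R : realType) (tau : finType) (n : nat)
    (C : {set model tau n}) : R := #|C|%:R / #|model tau n|%:R.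

Definition boltzmann_entropy (R : realType) (tau : finType) (n d : nat) : R :=
  \sum_(C in gmlu_classes tau n d) class_prob R C * log2 #|C|%:R.

Definition shannon_entropy (R : realType) (tau : finType) (n d : nat) : R :=
  - \sum_(C in gmlu_classes tau n d) class_prob R C * log2 (class_prob R C).

(* Main.v *)
Require Import Defs.
From mathcomp Require Import all_boot all_order all_algebra.
From mathcomp Require Import boolp reals exp.
From mathcomp Require Import zify.

Set Implicit Arguments.
Unset Strict Implicit.
Unset Printing Implicit Defensive.

Import Order.TTheory GRing.Theory Num.Theory.
Local Open Scope ring_scope.

(** Each point of a model has a type, the set of proposition symbols true at
    it.  A propositional formula defines a union of types, a formula with a
    leading modality holds at all points or at none, and counting up to [d]
    sees a cardinality only up to the threshold [d].  Hence two models are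
    equivalent at depth [d] exactly when, for every type, the numbers of points
    realising it agree after truncation at [d] ([gmlu_equivP]).

    If [n <= 2 d], the truncated counts determine the counts, because these sum
    to [n]: if a type is realised more than [d] times, every other one is
    realised less than [d] times ([truncated_counts_inj]).  All the relations
    with depth at least [n / 2] therefore coincide.  If [d < d'] and
    [2 d' <= n], the model realising two types [d] and [n - d] times is
    equivalent at depth [d], but not at depth [d'], to the one realising them
    [d + 1] and [n - d - 1] times, so the relation gets strictly finer.

    The Boltzmann entropy is the mean over all models of the logarithm of the
    size of the equivalence class ([boltzmann_entropyE]).  Refining the
    relation shrinks every class, and a strict refinement shrinks one strictly,
    so the mean decreases.  The Shannon entropy is the complement of the
    Boltzmann entropy to the constant [log2] of the number of models
    ([shannon_entropyE]), which gives the opposite inequality for it. *)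

(** * Types of points *)

Section Types.
Context (tau : finType) (n : nat).
Implicit Types (M N : model tau n) (t : {set tau}) (f : pform tau).

Definition ptype M (w : 'I_n) : {set tau} := [set p | w \in M p].

Definition type_count M t : nat := #|[set w | ptype M w == t]|.

Fixpoint peval t f : bool :=
  match f with
  | PVar p => p \in t
  | PNeg p => p \notin t
  | PAnd f1 f2 => peval t f1 && peval t f2
  | POr f1 f2 => peval t f1 || peval t f2
  end.

Lemma psatE M w f : psat M w f = peval (ptype M w) f.
Proof. by elim: f => [p|p|f1 /= -> f2 ->|f1 /= -> f2 ->] //=; rewrite inE. Qed.

Lemma card_ptype M (Q : pred {set tau}) :
  #|[set w | Q (ptype M w)]| = (\sum_(t | Q t) type_count M t)%N.
Proof.
rewrite -sum1dep_card (partition_big (ptype M) Q) //=.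
apply: eq_bigr => t Qt; rewrite /type_count -sum1dep_card.
by apply: eq_bigl => w; case: eqP => [->|_]; rewrite ?Qt ?andbF.
Qed.

Lemma sum_type_count M : (\sum_t type_count M t)%N = n.
Proof. by rewrite -(card_ptype M predT) cardsT card_ord. Qed.

(** The tautology on [p0] ends the conjunction, as the syntax has no constant
    for truth. *)
Definition type_pform (p0 : tau) t : pform tau :=
  foldr (fun p => PAnd (if p \in t then PVar p else PNeg p))
    (POr (PVar p0) (PNeg p0)) (enum tau).

Lemma psat_type_pform p0 M w t :
  psat M w (type_pform p0 t) = (ptype M w == t).
Proof.
have sat_foldr s : psat M w (foldr
    (fun p => PAnd (if p \in t then PVar p else PNeg p))
    (POr (PVar p0) (PNeg p0)) s) = all (fun p => (w \in M p) == (p \in t)) s.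
  elim: s => [|p s IHs] /=; first by rewrite orbN.
  by rewrite IHs; case: (p \in t) => /=; case: (w \in M p).
rewrite /type_pform sat_foldr; apply/allP/eqP => [eqMt|<- p _].
  by apply/setP => p; rewrite inE (eqP (eqMt p (mem_enum _ _))).
by rewrite inE.
Qed.

End Types.

(** * Equivalence at depth [d] as equality of truncated type counts *)

Section Truncation.
Variable d : nat.

Lemma leq_minn_congr (a b k : nat) :
  minn d a = minn d b -> (k <= d)%N -> (k <= a)%N = (k <= b)%N.
Proof.
by move=> eq_ab le_kd; have:= leq_min k d a; rewrite eq_ab leq_min le_kd.
Qed.

Lemma eqn_minn_congr (a b k : nat) :
  minn d a = minn d b -> (k < d)%N -> (a == k) = (b == k).
Proof.
move=> eq_ab lt_kd; rewrite !eqn_leq ![(_ <= k)%N]leqNgt.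
by rewrite !(leq_minn_congr eq_ab) // ltnW.
Qed.

Lemma minn_eqP (a b : nat) :
  (forall k, (k <= d)%N -> (k <= a)%N = (k <= b)%N) -> minn d a = minn d b.
Proof.
move=> eq_ab; apply/eqP.
rewrite eqn_leq !leq_min !geq_minl /=.
by rewrite -eq_ab ?geq_minl // geq_minr eq_ab ?geq_minl // geq_minr.
Qed.

(** Truncating the summands at [d] does not change the truncated sum, since a
    single summand of at least [d] already makes the sum saturate. *)
Lemma minn_sum_congr (I : finType) (P : pred I) (a b : I -> nat) :
  (forall i, minn d (a i) = minn d (b i)) ->
  minn d (\sum_(i | P i) a i) = minn d (\sum_(i | P i) b i).
Proof.
have minnD x y : minn d (x + y) = minn d (minn d x + minn d y).
  by rewrite !minnE; lia.
move=> eq_ab; elim/big_ind2: _ => // x1 x2 y1 y2 eqx eqy.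
by rewrite minnD eqx eqy -minnD.
Qed.

Lemma modality_sat_congr (T : finType) (q : modality) (A B : {set T}) :
  minn d #|A| = minn d #|B| -> minn d #|~: A| = minn d #|~: B| ->
  (modality_depth q <= d)%N -> modality_sat q A = modality_sat q B.
Proof.
move=> eqAB eqCAB; case: q => k /= le_kd.
- exact: leq_minn_congr eqAB le_kd.
- by rewrite (leq_minn_congr eqCAB le_kd).
- exact: eqn_minn_congr eqAB le_kd.
- by rewrite (eqn_minn_congr eqCAB le_kd).
Qed.

Context (tau : finType) (n : nat).
Implicit Types (M N : model tau n).

(** A propositional formula defines a union of types and so does its negation,
    so the truncated cardinals of both sets are sums of truncated counts, which
    is all that a modality of depth at most [d] sees.  Under nested modalities
    the two sets are even equal. *)
Lemma gmlu_equiv_of_counts M N :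
  (forall t, minn d (type_count M t) = minn d (type_count N t)) ->
  gmlu_equiv d M N.
Proof.
move=> eqMN.
have eq_card (Q : pred {set tau}) :
    minn d #|[set w | Q (ptype M w)]| = minn d #|[set w | Q (ptype N w)]|.
  by rewrite !card_ptype; apply: minn_sum_congr.
have eq_gsat f (w : 'I_n) : (cdepth f <= d)%N -> gsat M w f = gsat N w f.
  elim: f w => [q f|q f IHf|f1 IH1 f2 IH2|f1 IH1 f2 IH2] w /=.
  - have setE (L : model tau n) :
        [set v | psat L v f] = [set v | peval (ptype L v) f].
      by apply/setP => v; rewrite !inE psatE.
    have setCE (L : model tau n) : ~: [set v | peval (ptype L v) f]
        = [set v | ~~ peval (ptype L v) f].
      by apply/setP => v; rewrite !inE.
    rewrite !setE; apply: modality_sat_congr; rewrite ?setCE.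
      exact: (eq_card (fun t => peval t f)).
    exact: (eq_card (fun t => ~~ peval t f)).
  - rewrite geq_max => /andP[_ le_fd]; congr modality_sat.
    by apply/setP => v; rewrite !inE IHf.
  - by rewrite geq_max => /andP[le1 le2]; rewrite IH1 ?IH2.
  - by rewrite geq_max => /andP[le1 le2]; rewrite IH1 ?IH2.
by move=> f le_fd; apply: eq_forallb => w; apply: eq_gsat.
Qed.

(** Truncated counts are an invariant because a single formula, depending on
    [t] only, defines the points of type [t] in every model. *)
Lemma gmlu_equivP M N : (0 < #|tau|)%N -> (0 < n)%N ->
  gmlu_equiv d M N <->
  (forall t, minn d (type_count M t) = minn d (type_count N t)).
Proof.
move=> /card_gt0P[p0 _] n_gt0; split; last exact: gmlu_equiv_of_counts.
move=> eqMN t; apply: minn_eqP => k le_kd.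
have msat_count (L : model tau n) : msat L (GModP (DiaGe k) (type_pform p0 t))
    = (k <= type_count L t)%N.
  rewrite (msatE _ _ (Ordinal n_gt0)) /= /type_count.
  by congr (_ <= #|pred_of_set _|)%N; apply/setP=> w;
    rewrite !inE psat_type_pform.
by rewrite -!msat_count; apply: eqMN.
Qed.

Lemma gmlu_equivW d1 M N : (d1 <= d)%N -> gmlu_equiv d M N -> gmlu_equiv d1 M N.
Proof. by move=> le_d eqMN f le_f; apply: eqMN; apply: leq_trans le_d. Qed.

End Truncation.

(** If [a i > b i] for some [i], then, the sums being equal, [a j < b j] for some
    [j].  The truncations at [d] being equal, both inequalities compare numbers
    that are at least [d], so [a i + a j > 2 d], against the bound on the sum. *)
Lemma truncated_counts_le (I : finType) (d : nat) (a b : I -> nat) :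
  (\sum_i a i <= d.*2)%N -> (\sum_i a i = \sum_i b i)%N ->
  (forall i, minn d (a i) = minn d (b i)) -> forall i, (a i <= b i)%N.
Proof.
move=> le_sum eq_sum eq_min i; rewrite leqNgt; apply/negP => lt_ba.
have [j lt_ab] : exists j, (a j < b j)%N.
  apply/existsP; apply: contraT; rewrite negb_exists => /forallP ge_ab.
  suff: (\sum_i b i < \sum_i a i)%N by rewrite eq_sum ltnn.
  rewrite (bigD1 i) //= [X in (_ < X)%N](bigD1 i) //= -addSn leq_add //.
  by apply: leq_sum => k _; rewrite leqNgt ge_ab.
have neq_ji : j != i by apply/eqP => eq_ji; rewrite eq_ji in lt_ab; lia.
move: le_sum; rewrite (bigD1 i) //= (bigD1 j) //=.
have := eq_min i; have := eq_min j; rewrite !minnE; lia.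
Qed.

Lemma truncated_counts_inj (I : finType) (d : nat) (a b : I -> nat) :
  (\sum_i a i <= d.*2)%N -> (\sum_i a i = \sum_i b i)%N ->
  (forall i, minn d (a i) = minn d (b i)) -> a =1 b.
Proof.
move=> le_sum eq_sum eq_min i; apply/eqP; rewrite eqn_leq.
by rewrite !(@truncated_counts_le I d) // -eq_sum.
Qed.

Lemma gmlu_equiv_stable (tau : finType) (n d d' : nat) (M N : model tau n) :
  (0 < #|tau|)%N -> (0 < n)%N -> (n <= d.*2)%N -> (d <= d')%N ->
  gmlu_equiv d M N <-> gmlu_equiv d' M N.
Proof.
move=> tau_gt0 n_gt0 le_nd le_dd'; split; last exact: gmlu_equivW.
move=> /gmlu_equivP-/(_ tau_gt0 n_gt0) eqMN.
apply: gmlu_equiv_of_counts => t; congr minn.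
by apply: (@truncated_counts_inj _ d) => //; rewrite !sum_type_count.
Qed.

(** The witnesses interpret all symbols by one set, of [d] or [d + 1] points, so
    that only the full and the empty type are realised.  Their counts are all
    at least [d] since [2 d + 1 < n], hence invisible at depth [d]. *)
Lemma gmlu_equiv_strict (tau : finType) (n d d' : nat) :
  (0 < #|tau|)%N -> (0 < n)%N -> (d < d')%N -> (d'.*2 <= n)%N ->
  exists M N : model tau n, gmlu_equiv d M N /\ ~ gmlu_equiv d' M N.
Proof.
move=> /card_gt0P[p0 _] n_gt0 lt_dd' le_d'n.
pose seg k : {set 'I_n} := [set w : 'I_n | (w < k)%N].
have card_seg k : (k <= n)%N -> #|seg k| = k.
  move=> le_kn; rewrite -sum1dep_card -(big_ord_widen _ (fun=> 1%N)) //.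
  by rewrite sum1_card card_ord.
pose mod k : model tau n := [ffun=> seg k].
exists (mod d), (mod d.+1); split.
  apply: gmlu_equiv_of_counts => t.
  have ptypeE k w : ptype (mod k) w = if w \in seg k then setT else set0.
    by apply/setP => p; rewrite inE ffunE; case: (w \in seg k); rewrite inE.
  have neqT0 : (setT == set0 :> {set tau}) = false.
    by apply/eqP => /setP/(_ p0); rewrite !inE.
  have countE k : (k <= n)%N -> type_count (mod k) t =
      if t == setT then k else if t == set0 then (n - k)%N else 0%N.
    move=> le_kn; have cardC : #|~: seg k| = (n - k)%N.
      by have := cardsC (seg k); rewrite card_seg // card_ord; lia.
    rewrite /type_count; case: eqP => [->|neq_tT].
      rewrite -[RHS](card_seg k le_kn); apply: eq_card => w.
      rewrite inE ptypeE; case: ifP => _; rewrite ?eqxx //.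
      by rewrite eq_sym neqT0.
    case: eqP => [->|neq_t0].
      rewrite -cardC; apply: eq_card => w; rewrite !inE ptypeE inE.
      by case: ltnP; rewrite ?eqxx ?neqT0.
    apply: eq_card0 => w; rewrite inE ptypeE.
    by case: ifP => _; apply/eqP => eq_t; [case: neq_tT|case: neq_t0].
  rewrite !countE; try lia.
  by case: ifP => _; [|case: ifP => _ //]; rewrite !minnE; lia.
(* That [p0] holds at [d + 1] points or more separates the two models. *)
move=> /(_ (GModP (DiaGe d.+1) (PVar p0)) lt_dd').
have setE k : [set v : 'I_n | v \in mod k p0] = seg k.
  by apply/setP => v; rewrite inE ffunE.
by rewrite !(msatE _ _ (Ordinal n_gt0)) /= !setE !card_seg ?ltnn ?leqnn //; lia.
Qed.

(** * Entropies as means over the models *)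

Section Entropy.
Context (R : realType) (tau : finType) (n : nat).
Implicit Types (M N : model tau n) (d : nat).

Definition gmlu_class d M : {set model tau n} :=
  [set N | `[< gmlu_equiv d M N >]].

Lemma gmlu_equiv_rel d :
  {in [set: model tau n] & &,
    equivalence_rel (fun M N => `[< gmlu_equiv d M N >])}.
Proof.
move=> M N L _ _ _; split; first by apply/asboolP.
move=> /asboolP eqMN; apply/asboolP/asboolP => eqL f le_f.
  by rewrite -eqMN ?eqL.
by rewrite eqMN ?eqL.
Qed.

Lemma gmlu_classesP d : partition (gmlu_classes tau n d) [set: model tau n].
Proof. exact: equivalence_partitionP (gmlu_equiv_rel d). Qed.

Lemma pblock_gmlu_classes d M : pblock (gmlu_classes tau n d) M = gmlu_class d M.
Proof.
apply/setP => N; rewrite [RHS]inE.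
by rewrite (pblock_equivalence_partition (gmlu_equiv_rel d)).
Qed.

(** The weight of a class counts the models in it, and each of them has that
    class as its block; this turns both entropies into means over models, which
    can be compared term by term for different depths. *)
Lemma sum_gmlu_classes d (F : {set model tau n} -> R) :
  \sum_(C in gmlu_classes tau n d) class_prob R C * F C =
  (\sum_M F (gmlu_class d M)) / #|model tau n|%:R.
Proof.
have /and3P[/eqP cov triv _] := gmlu_classesP d.
rewrite (eq_bigl (mem (cover (gmlu_classes tau n d)))) => [|M]; last first.
  by rewrite /= cov inE.
rewrite big_trivIset //=.
rewrite mulr_suml; apply: eq_bigr => C CP.
rewrite (eq_bigr (fun=> F C)) => [|M MC].
  by rewrite sumr_const /class_prob -[F C *+ _]mulr_natl mulrAC.
by rewrite -pblock_gmlu_classes (def_pblock triv CP MC).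
Qed.

Lemma card_model_gt0 : 0 < #|model tau n|%:R :> R.
Proof. by rewrite ltr0n; apply/card_gt0P; exists [ffun=> set0]. Qed.

Lemma card_gmlu_class_gt0 d M : 0 < #|gmlu_class d M|%:R :> R.
Proof.
by rewrite ltr0n; apply/card_gt0P; exists M; rewrite inE; apply/asboolP.
Qed.

Lemma boltzmann_entropyE d : boltzmann_entropy R tau n d =
  (\sum_M log2 (#|gmlu_class d M|%:R : R)) / #|model tau n|%:R.
Proof. exact: (sum_gmlu_classes d (fun C => log2 #|C|%:R)). Qed.

Lemma shannon_entropyE d : shannon_entropy R tau n d =
  log2 #|model tau n|%:R - boltzmann_entropy R tau n d.
Proof.
rewrite /shannon_entropy boltzmann_entropyE.
rewrite (sum_gmlu_classes d (fun C => log2 (class_prob R C))).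
have logE M : log2 (class_prob R (gmlu_class d M)) =
    log2 #|gmlu_class d M|%:R - log2 #|model tau n|%:R.
  by rewrite /log2 /class_prob ln_div ?posrE ?card_gmlu_class_gt0
    ?card_model_gt0 // mulrBl.
rewrite (eq_bigr _ (fun M _ => logE M)) sumrB sumr_const.
rewrite -[_ *+ #|_|]mulr_natl mulrBl opprB mulrAC divff ?mul1r //.
by rewrite gt_eqF // card_model_gt0.
Qed.

(** All classes shrink when the depth grows, and the class of [M] loses [N]. *)
Lemma boltzmann_entropy_lt d d' M N : (d <= d')%N ->
  gmlu_equiv d M N -> ~ gmlu_equiv d' M N ->
  boltzmann_entropy R tau n d' < boltzmann_entropy R tau n d.
Proof.
move=> le_dd' eqMN neqMN.
have ln2_gt0 : 0 < ln 2 :> R by rewrite ln_gt0 // ltr1n.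
have sub_class L : gmlu_class d' L \subset gmlu_class d L.
  apply/subsetP => K; rewrite !inE => /asboolP eqLK.
  by apply/asboolP; apply: gmlu_equivW eqLK.
rewrite !boltzmann_entropyE ltr_pM2r ?invr_gt0 ?card_model_gt0 //.
rewrite (bigD1 M) //= [ltRHS](bigD1 M) //=; apply: ltr_leD.
  rewrite ltr_pM2r ?invr_gt0 // ltr_ln ?posrE ?card_gmlu_class_gt0 // ltr_nat.
  apply: proper_card; rewrite properE sub_class; apply/subsetPn.
  by exists N; rewrite inE; [apply/asboolP|apply/asboolPn].
apply: ler_sum => L _.
rewrite ler_pM2r ?invr_gt0 // ler_ln ?posrE ?card_gmlu_class_gt0 // ler_nat.
exact: subset_leq_card.
Qed.

End Entropy.

Theorem proposition5p1 (R : realType) (tau : finType) (n d d' : nat)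
    (tau_gt0 : (0 < #|tau|)%N) (n_gt0 : (0 < n)%N)
    (d_gt0 : (0 < d)%N) (d'_gt0 : (0 < d')%N) :
  ((d < d')%N -> d'%:R <= n%:R / 2 :> R ->
     shannon_entropy R tau n d < shannon_entropy R tau n d' /\
     boltzmann_entropy R tau n d > boltzmann_entropy R tau n d') /\
  (n%:R / 2 <= d%:R :> R -> (d <= d')%N ->
     shannon_entropy R tau n d = shannon_entropy R tau n d' /\
     boltzmann_entropy R tau n d = boltzmann_entropy R tau n d').
Proof.
split=> [lt_dd'|].
  rewrite ler_pdivlMr // -natrM ler_nat muln2 => le_d'n.
  have [M [N [eqMN neqMN]]] :=
    gmlu_equiv_strict tau_gt0 n_gt0 lt_dd' le_d'n.
  have ltB := boltzmann_entropy_lt R (ltnW lt_dd') eqMN neqMN.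
  by rewrite !shannon_entropyE ltrD2l ltrN2.
rewrite ler_pdivrMr // -natrM ler_nat muln2 => le_nd le_dd'.
suff eq_classes : gmlu_classes tau n d = gmlu_classes tau n d'.
  by rewrite /shannon_entropy /boltzmann_entropy eq_classes.
congr equivalence_partition; apply/funext => M; apply/funext => N.
by congr asbool; apply/propext; apply: gmlu_equiv_stable.
Qed.
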